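(* Let $n\in\mathbb{N}$, $n\ge 1$, let $(u_i)_{i=1}^{2^n-1}$ be a convex sequence of real numbers, and let $T(V,E)$ be the (unweighted) perfect binary tree with $n-1$ levels excluding the root (so $|V|=2^n-1$). Then the sequence can be embedded into $T$ so as to make it type-$2$ convex; that is, there is a bijection $\varphi:V\to\{1,2,\dots,2^n-1\}$ such that, with the weights $w(v):=u_{\varphi(v)}$, the tree $T(V,E,w)$ is type-$2$ convex.
   Context: A finite sequence $(u_i)_{i=1}^{N}$ of real numbers is convex if $2u_i\le u_{i-1}+u_{i+1}$ for all $i$ with $2\le i\le N-1$. A perfect binary tree is a rooted tree in which every internal node has exactly two children and all leaves are at the same level; with $n-1$ levels excluding the root, level $i$ (for $0\le i\le n-1$, level $0$ being the root) has exactly $2^i$ nodes. A rooted tree $T(V,E,w)$ with vertex weights $w$ is type-$2$ convex if for every internal vertex $v$ having at least two children, and every two distinct children $v_1,v_2$ of $v$, $2w(v)\le w(v_1)+w(v_2)$. *)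

(* Defs.v *)
From HB Require Import structures.
From mathcomp Require Import all_boot all_order all_algebra.
From mathcomp Require Import reals.

Set Implicit Arguments.
Unset Strict Implicit.
Unset Printing Implicit Defensive.

Import Order.TTheory GRing.Theory Num.Theory.
Local Open Scope ring_scope.

(* The indices 1, ..., N are represented by 'I_N, shifted by one; the
   condition below thus ranges over the interior indices only. *)
Definition convex_seq (R : numDomainType) (N : nat) (u : 'I_N -> R) : Prop :=
  forall i j k : 'I_N, j = i.+1 :> nat -> k = j.+1 :> nat ->
    2 * u j <= u i + u k.

(* A 2-element sequence [:: x; y] with x and y adjacent is a ucycle of a
   symmetric relation, hence the bound 2. *)
Definition acyclic (V : finType) (e : rel V) : Prop :=
  forall c : seq V, ucycle e c -> (size c <= 2)%N.

Record rooted_tree := RootedTree {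
  vertex :> finType;
  edge : rel vertex;
  tree_root : vertex;
  edge_sym : symmetric edge;
  edge_irr : irreflexive edge;
  edge_connected : forall x y : vertex, connect edge x y;
  edge_acyclic : acyclic edge
}.

(* The least length of a walk from x to y; it is at most #|V| - 1 when x and y
   are connected, and the value of find is #|V| otherwise. *)
Definition graph_dist (V : finType) (e : rel V) (x y : V) : nat :=
  find (fun k => [exists p : k.-tuple V, path e x p && (last x p == y)])
       (iota 0 #|V|).

Definition level (T : rooted_tree) (v : T) : nat :=
  graph_dist (@edge T) (tree_root T) v.

Definition children (T : rooted_tree) (v : T) : {set T} :=
  [set c : T | edge v c && (level c == (level v).+1)].

Definition internal (T : rooted_tree) (v : T) : bool := children v != set0.

Definition leaf (T : rooted_tree) (v : T) : bool := ~~ internal v.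

(* h is the number of levels excluding the root. *)
Definition perfect_binary_tree (T : rooted_tree) (h : nat) : Prop :=
  (forall v : T, internal v -> #|children v| = 2%N) /\
  (forall v : T, leaf v -> level v = h).

Definition type2_convex (R : numDomainType) (T : rooted_tree) (w : T -> R) :
    Prop :=
  forall v : T, internal v -> (2 <= #|children v|)%N ->
  forall v1 v2 : T, v1 \in children v -> v2 \in children v -> v1 != v2 ->
    2 * w v <= w v1 + w v2.

(* Main.v *)
Require Import Defs.
From HB Require Import structures.
From mathcomp Require Import all_boot all_order all_algebra.
From mathcomp Require Import reals.
From mathcomp Require Import zify lra.

Set Implicit Arguments.
Unset Strict Implicit.
Unset Printing Implicit Defensive.

Import Order.TTheory GRing.Theory Num.Theory.
Local Open Scope ring_scope.

(** The embedding is the in-order numbering of the tree.  List the nodes of one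
    level from left to right: in a tree of height h, the c-th node of level l
    (with c counted from 0) receives the number (2 c + 1) 2 ^ (h - l).  So the
    root lies in the middle of 1, ..., 2 ^ (h + 1) - 1, and the children 2 c and
    2 c + 1 of the node c lie at the numbers of that node minus and plus
    2 ^ (h - l - 1).  The number of a node is therefore the exact midpoint of
    the numbers of its two children, and a convex sequence satisfies
    2 u_m <= u_(m - d) + u_(m + d) for every d, not only for d = 1
    ([convex_seq_midpoint]).

    The numbering is injective because a positive integer is an odd number times
    a power of 2 in only one way, which recovers the level and the rank c, and
    because the binary digits of c spell the path from the root to the node
    ([rank_inj]).  It is onto because every such path exists: in a perfect
    tree each node above the bottom level has both children ([rank_surj]).

    Both facts rest on the correspondence between nodes and paths from the root,
    which for a tree given as a connected acyclic graph means that each node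
    other than the root has exactly one neighbour on the level above it.  Such a
    neighbour exists on a shortest walk from the root; two of them would be
    joined through the levels above, which closes a cycle ([parent_uniq]). *)

(** * Convex sequences *)

Section NatConvexity.
Variables (R : realDomainType) (N : nat) (f : nat -> R).
Hypothesis f_convex :
  forall i, (i.+2 < N)%N -> 2 * f i.+1 <= f i + f i.+2.

Lemma convex_increments i d : ((i + d).+1 < N)%N ->
  f i.+1 - f i <= f (i + d).+1 - f (i + d)%N.
Proof.
elim: d => [|d IHd] lt_idN; first by rewrite addn0.
move: lt_idN; rewrite addnS => lt_idN.
have := IHd (ltnW lt_idN); have := f_convex lt_idN.
lra.
Qed.

(** When d grows by 1, f (i + 2 d) + f i changes by the difference of two
    increments of f, the right one minus the left one. *)
Lemma convex_midpoint i d : (i + d + d < N)%N ->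
  2 * f (i + d)%N <= f i + f (i + d + d)%N.
Proof.
elim: d i => [|d IHd] i lt_N; first by rewrite !addn0; lra.
have := IHd i.+1; have := @convex_increments i d.*2.+1.
have -> : (i.+1 + d = i + d.+1)%N by lia.
have -> : (i + d.+1 + d = i + d.*2.+1)%N by lia.
have -> : (i + d.+1 + d.+1 = (i + d.*2.+1).+1)%N by lia.
move=> /(_ ltac:(lia)) incr /(_ ltac:(lia)).
lra.
Qed.

End NatConvexity.

Lemma convex_seq_midpoint (R : realDomainType) N (u : 'I_N -> R) :
  convex_seq u -> forall i j k : 'I_N, (i + k = j.*2)%N ->
  2 * u j <= u i + u k.
Proof.
move=> u_convex.
pose f m := oapp u 0 (insub m).
have fE (i : 'I_N) : f i = u i by rewrite /f valK.
have f_convex i : (i.+2 < N)%N -> 2 * f i.+1 <= f i + f i.+2.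
  move=> lt2; have lt1 := ltnW lt2.
  have := u_convex (Ordinal (ltnW lt1)) (Ordinal lt1) (Ordinal lt2) erefl erefl.
  by rewrite -!fE.
suff main (i j k : 'I_N) : (i <= k)%N -> (i + k = j.*2)%N ->
    2 * u j <= u i + u k.
  move=> i j k; case: (leqP i k) => [|/ltnW] le_ik eq_ikj; first exact: main.
  by rewrite addrC; apply: main => //; rewrite addnC.
move=> le_ik eq_ikj; rewrite -!fE.
have [d def_d] : exists d, d = (j - i)%N by eexists.
have def_k : k = (i + d + d)%N :> nat by lia.
have -> : j = (i + d)%N :> nat by lia.
by rewrite def_k; apply: (convex_midpoint f_convex); rewrite -def_k.
Qed.

(** * Distances in a graph *)

Lemma graph_dist_path (V : finType) (e : rel V) x p :
  path e x p -> (graph_dist e x (last x p) <= size p)%N.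
Proof.
move=> e_p; rewrite /graph_dist; set a := (X in find X _).
have le_findV : (find a (iota 0 #|V|) <= #|V|)%N.
  by rewrite -[leqRHS](size_iota 0) find_size.
(* A walk of length at least #|V| is outside the range of the search, but the
   search never returns more than #|V|. *)
case: (ltnP (size p) #|V|) => [lt_pV | le_Vp]; last exact: leq_trans le_Vp.
rewrite leqNgt; apply/negP => /(before_find 0); rewrite nth_iota // add0n.
by move/existsP; apply; exists (in_tuple p); rewrite e_p eqxx.
Qed.

Lemma graph_dist_geodesic (V : finType) (e : rel V) x y : connect e x y ->
  exists p, [/\ path e x p, last x p = y & size p = graph_dist e x y].
Proof.
case/connectP => q e_q ->; case: (shortenP e_q) => p e_p Up _.
rewrite /graph_dist; set a := (X in find X _).
have lt_pV : (size p < #|V|)%N by have := max_card (mem (x :: p)); rewrite (card_uniqP Up).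
have ha : has a (iota 0 #|V|).
  apply/hasP; exists (size p); first by rewrite mem_iota.
  by apply/existsP; exists (in_tuple p); rewrite e_p eqxx.
have := nth_find 0%N ha.
rewrite nth_iota; last by rewrite -[X in (_ < X)%N](size_iota 0) -has_find.
case/existsP => r /andP[e_r /eqP last_r]; exists r.
by rewrite e_r last_r size_tuple.
Qed.

(** * Levels, parents and ranks in a rooted tree *)

Section RootedTree.
Variable T : rooted_tree.
Implicit Types v p c : T.

Lemma level_path (s : seq T) : path (@edge T) (tree_root T) s ->
  (level (last (tree_root T) s) <= size s)%N.
Proof. exact: graph_dist_path. Qed.

Lemma level_geodesic v : exists s,
  [/\ path (@edge T) (tree_root T) s, last (tree_root T) s = v
    & size s = level v].
Proof. exact/graph_dist_geodesic/edge_connected. Qed.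

Lemma level_root : level (tree_root T) = 0%N.
Proof. by apply/eqP; rewrite -leqn0; apply: (@level_path [::]). Qed.

Lemma level_eq0 v : level v = 0%N -> v = tree_root T.
Proof.
by have [s [_ last_s <-]] := level_geodesic v; move/size0nil=> s0; rewrite -last_s s0.
Qed.

Lemma mem_children v c :
  (c \in children v) = edge v c && (level c == (level v).+1).
Proof. by rewrite inE. Qed.

Lemma level_child v c : c \in children v -> level c = (level v).+1.
Proof. by rewrite mem_children => /andP[_ /eqP]. Qed.

Lemma parent_exists v l : level v = l.+1 -> exists p, v \in children p.
Proof.
move=> lv; have [s [e_s last_s size_s]] := level_geodesic v.
case/lastP: s => [|s c] in e_s last_s size_s; first by rewrite lv in size_s.
rewrite last_rcons in last_s; subst c; rewrite rcons_path in e_s.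
rewrite size_rcons in size_s; case/andP: e_s => e_s e_v.
exists (last (tree_root T) s); rewrite mem_children e_v /= eqn_leq.
rewrite -{2}size_s ltnS (level_path e_s) andbT.
have [r [e_r last_r size_r]] := level_geodesic (last (tree_root T) s).
have := @level_path (rcons r v).
by rewrite rcons_path e_r last_r e_v last_rcons size_rcons size_r; apply.
Qed.

Lemma connect_upper_levels l v : (level v <= l)%N ->
  connect [rel x y : T | [&& edge x y, level x <= l & level y <= l]%N]
    (tree_root T) v.
Proof.
move lv: (level v) => k; elim: k v lv => [|k IHk] v lv le_kl.
  by rewrite (level_eq0 lv) connect0.
have [p v_p] := parent_exists lv.
have lp : level p = k by move: (level_child v_p); rewrite lv => -[].
apply: connect_trans (IHk p lp (ltnW le_kl)) (connect1 _).
rewrite /= lv lp (ltnW le_kl) le_kl.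
by move: v_p; rewrite mem_children => /andP[->].
Qed.

(** Two parents of v would be joined by a simple path in the levels above v;
    going through v closes it to a cycle with at least three vertices. *)
Lemma parent_uniq v p q : v \in children p -> v \in children q -> p = q.
Proof.
move=> v_p v_q; apply/eqP/idP; apply: contraT => neq_pq.
have lp := level_child v_p; have lq := level_child v_q.
have eq_lpq : level q = level p by move: lq; rewrite lp => -[].
pose e := [rel x y : T | [&& edge x y, level x <= level p & level y <= level p]%N].
have e_sym : symmetric e by move=> x y; rewrite /= edge_sym [X in _ && X]andbC.
have : connect e p q.
  apply: (@connect_trans _ _ (tree_root T)).
    by rewrite (sym_connect_sym e_sym) connect_upper_levels.
  by apply: connect_upper_levels; rewrite eq_lpq.
case/connectP => s0 e_s0; case: (shortenP e_s0) => s e_s Us _ def_q.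
have edge_s : path (@edge T) p s by apply: sub_path e_s => x y /andP[].
have v_notin_s : v \notin p :: s.
  rewrite inE negb_or; apply/andP; split.
    by apply/eqP => def_v; move: lp; rewrite def_v; lia.
  apply/negP => v_s; have [i lt_is def_v] := nthP p v_s.
  have /and3P[_ _] := pathP p e_s i lt_is.
  by rewrite def_v lp ltnn.
have : ucycle (@edge T) (v :: p :: s).
  rewrite /ucycle /= rcons_path edge_s -def_q.
  move: v_p v_q; rewrite !mem_children => /andP[e_pv _] /andP[-> _].
  by rewrite edge_sym e_pv; move: v_notin_s Us => /= -> ->.
move/edge_acyclic; case: s def_q {e_s Us edge_s v_notin_s} => //= def_q.
by rewrite def_q eqxx in neq_pq.
Qed.

Definition parent v : T := odflt v [pick p | v \in children p].

Lemma parent_child v c : c \in children v -> parent c = v.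
Proof.
move=> c_v; rewrite /parent; case: pickP => [p c_p | /(_ v)].
  exact: parent_uniq c_p c_v.
by rewrite c_v.
Qed.

Definition birth_order v : nat := index v (enum (children (parent v))).

(** The binary digits of this number, most significant first, are the birth orders along
    the path from the ancestor of v that lies l levels above v down to v. *)
Fixpoint rank_from (l : nat) v : nat :=
  if l is l'.+1 then ((rank_from l' (parent v)).*2 + birth_order v)%N else 0%N.

Definition rank v : nat := rank_from (level v) v.

Lemma rank_child v c : c \in children v ->
  rank c = ((rank v).*2 + birth_order c)%N.
Proof. by move=> c_v; rewrite /rank (level_child c_v) /= (parent_child c_v). Qed.

Lemma birth_orderE v c : c \in children v ->
  birth_order c = index c (enum (children v)).
Proof. by move=> c_v; rewrite /birth_order (parent_child c_v). Qed.

(** * Perfect binary trees *)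

Section Perfect.
Variable h : nat.
Hypothesis T_perfect : perfect_binary_tree T h.

(** A vertex of greatest level has no children, so its level is h. *)
Lemma level_le_height v : (level v <= h)%N.
Proof.
case: (@arg_maxnP T (tree_root T) predT (@level T) isT) => m _ m_max.
suff <- : level m = h by exact: m_max.
apply: T_perfect.2; rewrite /leaf negbK; apply/eqP/setP => c; rewrite in_set0.
apply/negP => c_m; have := m_max c isT.
by rewrite (level_child c_m) /= ltnn.
Qed.

Lemma internalE v : internal v = (level v < h)%N.
Proof.
apply/idP/idP => [/set0Pn[c c_v] | lt_vh].
  by rewrite -(level_child c_v) level_le_height.
by apply: contraLR lt_vh => v_leaf; rewrite (T_perfect.2 _ v_leaf) ltnn.
Qed.

Lemma birth_order_lt2 v c : c \in children v -> (birth_order c < 2)%N.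
Proof.
move=> c_v; rewrite (birth_orderE c_v) -(T_perfect.1 v).
  by rewrite cardE index_mem mem_enum.
by apply/set0Pn; exists c.
Qed.

Lemma birth_order_inj v c d : c \in children v -> d \in children v ->
  birth_order c = birth_order d -> c = d.
Proof.
move=> c_v d_v; rewrite (birth_orderE c_v) (birth_orderE d_v).
by apply: (index_inj c); rewrite mem_enum.
Qed.

Lemma rank_lt v : (rank v < 2 ^ level v)%N.
Proof.
move lv: (level v) => l; elim: l v lv => [|l IHl] v lv; first by rewrite /rank lv.
have [p v_p] := parent_exists lv.
have lp : level p = l by move: (level_child v_p); rewrite lv => -[].
rewrite (rank_child v_p) expnS.
by have := birth_order_lt2 v_p; have := IHl p lp; lia.
Qed.

Lemma rank_inj v w : level v = level w -> rank v = rank w -> v = w.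
Proof.
move lv: (level v) => l; elim: l v w lv => [|l IHl] v w lv /esym lw.
  by rewrite (level_eq0 lv) (level_eq0 lw).
have [p v_p] := parent_exists lv; have [q w_q] := parent_exists lw.
have lp : level p = l by move: (level_child v_p); rewrite lv => -[].
have lq : level q = l by move: (level_child w_q); rewrite lw => -[].
have := birth_order_lt2 v_p; have := birth_order_lt2 w_q.
rewrite (rank_child v_p) (rank_child w_q) => w2 v2 eq_rank.
have eq_pq : p = q by apply: IHl; rewrite ?lq //; lia.
rewrite -eq_pq in w_q eq_rank; apply: (birth_order_inj v_p w_q).
lia.
Qed.

Lemma rank_surj l k : (l <= h)%N -> (k < 2 ^ l)%N ->
  exists v, level v = l /\ rank v = k.
Proof.
elim: l k => [|l IHl] k le_lh lt_k.
  exists (tree_root T); rewrite /rank level_root; split=> //.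
  by case: k lt_k.
have [||p [lp rp]] := IHl k./2; first exact: ltnW.
  by move: lt_k; rewrite expnS; lia.
have p_int : internal p by rewrite internalE lp.
have lt_odd : (odd k < size (enum (children p)))%N.
  by rewrite -cardE (T_perfect.1 _ p_int); case: (odd k).
pose c := nth p (enum (children p)) (odd k).
have c_p : c \in children p by rewrite -mem_enum mem_nth.
exists c; rewrite (level_child c_p) (rank_child c_p) (birth_orderE c_p) lp rp.
by rewrite index_uniq ?enum_uniq //; split=> //; lia.
Qed.

Definition inorder v : nat := ((rank v).*2.+1 * 2 ^ (h - level v))%N.

Lemma inorder_gt0 v : (0 < inorder v)%N.
Proof. by rewrite muln_gt0 expn_gt0. Qed.

Lemma inorder_lt v : (inorder v < 2 ^ h.+1)%N.
Proof.
have -> : (h.+1 = (level v).+1 + (h - level v))%N.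
  by rewrite addSn subnKC // level_le_height.
rewrite /inorder expnD ltn_pmul2r ?expn_gt0 // expnS.
by have := rank_lt v; lia.
Qed.

Lemma inorder_inj : injective inorder.
Proof.
have log_inorder v : logn 2 (inorder v) = (h - level v)%N.
  rewrite lognM ?expn_gt0 // pfactorK //.
  by rewrite logn_coprime // coprime2n /= odd_double.
move=> v w eq_vw; have eq_level : level v = level w.
  have := congr1 (logn 2) eq_vw; rewrite !log_inorder.
  by have := level_le_height v; have := level_le_height w; lia.
apply: (rank_inj eq_level); move/eqP: eq_vw.
by rewrite /inorder eq_level eqn_pmul2r ?expn_gt0 // => /eqP; lia.
Qed.

Lemma inorder_surj k : (0 < k < 2 ^ h.+1)%N -> exists v, inorder v = k.
Proof.
case/andP=> k_gt0 lt_k.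
have [m] := pfactor_coprime (isT : prime 2) k_gt0; rewrite coprime2n.
move: (logn 2 k) => j odd_m def_k.
have m_gt0 : (0 < m)%N by case: m odd_m {def_k}.
have le_jh : (j <= h)%N.
  rewrite -ltnS -(ltn_exp2l _ _ (isT : 1 < 2)%N); apply: leq_ltn_trans lt_k.
  by rewrite def_k leq_pmull.
have lt_m : (m./2 < 2 ^ (h - j))%N.
  move: lt_k; have -> : (h.+1 = (h - j).+1 + j)%N by lia.
  by rewrite def_k expnD ltn_pmul2r ?expn_gt0 // expnS; lia.
have [v [lv rv]] := rank_surj (leq_subr j h) lt_m.
by exists v; rewrite /inorder lv rv subKn // def_k; congr (_ * _)%N; lia.
Qed.

(** The two siblings have ranks 2 c and 2 c + 1 in some order, so their numbers
    add up to (4 c + 1) + (4 c + 3) = 4 (2 c + 1) units of the lower level. *)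
Lemma inorder_children v c d : c \in children v -> d \in children v ->
  c != d -> (inorder c + inorder d = (inorder v).*2)%N.
Proof.
move=> c_v d_v neq_cd.
have lt_vh : (level v < h)%N by rewrite -(level_child c_v) level_le_height.
have : birth_order c <> birth_order d.
  by move/(birth_order_inj c_v d_v)/eqP; rewrite (negPf neq_cd).
have := birth_order_lt2 c_v; have := birth_order_lt2 d_v.
rewrite /inorder (rank_child c_v) (rank_child d_v).
rewrite (level_child c_v) (level_child d_v) subnS.
have -> : (h - level v = (h - level v).-1.+1)%N by lia.
rewrite [(_.+1).-1]/= expnS -mulnDl mulnA doubleMl => d2 c2 neq.
by congr (_ * _)%N; lia.
Qed.

End Perfect.

End RootedTree.

(** * The embedding *)

Theorem theorem2p1 (R : realType) (n : nat) (hn : (1 <= n)%N)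
    (u : 'I_(2 ^ n - 1)%N -> R) (hu : convex_seq u)
    (T : rooted_tree) (hT : perfect_binary_tree T (n - 1)%N) :
  exists phi : T -> 'I_(2 ^ n - 1)%N,
    bijective phi /\ type2_convex (fun v : T => u (phi v)).
Proof.
pose pos (v : T) := inorder (n - 1) v.
have n_eq : (n - 1).+1 = n by lia.
have pos_gt0 v : (0 < pos v)%N by exact: inorder_gt0.
(* The indices of u start at 0, the in-order numbers at 1. *)
have lt_pos v : ((pos v).-1 < 2 ^ n - 1)%N.
  by have := inorder_lt hT v; have := pos_gt0 v; rewrite n_eq /pos; lia.
exists (fun v => Ordinal (lt_pos v)); split; last first.
  move=> v _ _ c d c_v d_v neq_cd; apply: (convex_seq_midpoint hu) => /=.
  have := inorder_children hT c_v d_v neq_cd; rewrite -!/(pos _).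
  by have := pos_gt0 c; have := pos_gt0 d; have := pos_gt0 v; lia.
apply: inj_card_bij => [v w [eq_vw] |].
  apply: (inorder_inj hT); rewrite -!/(pos _).
  by have := pos_gt0 v; have := pos_gt0 w; lia.
apply: leq_trans (leq_image_card (fun v => Ordinal (lt_pos v)) T).
apply/subset_leq_card/subsetP => k _.
have [|v pos_v] := inorder_surj hT (k := k.+1).
  by rewrite n_eq; have := ltn_ord k; lia.
by apply/codomP; exists v; apply: val_inj; rewrite /= /pos pos_v.
Qed.
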